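(* Let $(\Omega,\mathcal F)$ be a measurable space and let $\mathcal P$ be an arbitrary nonempty set of probability measures on it. For any probability measure $\mathsf Q$ on $(\Omega,\mathcal F)$, $$\sup_{X\in\mathcal E}\mathbb E_{\mathsf Q}[\log X]=\sup_{X\in\mathcal E_b}\mathbb E_{\mathsf Q}[\log X].$$
   Context: An e-variable for $\mathcal P$ is a measurable $X:\Omega\to[0,\infty]$ with $\int X\,d\mathsf P\le1$ for all $\mathsf P\in\mathcal P$; $\mathcal E$ is the set of all e-variables and $\mathcal E_b$ the subset of those bounded from above, $\sup_\omega X(\omega)<\infty$. Conventions: $\log0=-\infty$, $\log\infty=\infty$; $\mathbb E_{\mathsf Q}[\log X]=\mathbb E_{\mathsf Q}[(\log X)^+]-\mathbb E_{\mathsf Q}[(\log X)^-]$ if $\mathbb E_{\mathsf Q}[(\log X)^-]<\infty$, and $=-\infty$ if $\mathbb E_{\mathsf Q}[(\log X)^-]=\infty$. *)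

(* Defs.v *)
From HB Require Import structures.
From mathcomp Require Import all_boot all_order all_algebra.
From mathcomp Require Import all_classical all_reals all_analysis.
From mathcomp Require Import measurable_realfun.

Set Implicit Arguments.
Unset Strict Implicit.
Unset Printing Implicit Defensive.

Local Open Scope classical_set_scope.
Local Open Scope ereal_scope.

Section evariables.
Context (d : measure_display) (T : measurableType d) (R : realType).
Implicit Types (PP : set (probability T R)) (X : T -> \bar R).

Definition evariables PP : set (T -> \bar R) :=
  [set X : T -> \bar R | [/\ measurable_fun setT X,
               forall w, 0 <= X w
             & forall P : probability T R, PP P -> \int[P]_w X w <= 1]].

Definition bounded_evariables PP : set (T -> \bar R) :=
  [set X : T -> \bar R | evariables PP X /\ ereal_sup (range X) < +oo].

(* [lne 0 = -oo] and [lne +oo = +oo]. When the integral of the negative part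
   is infinite the value is [-oo], even if that of the positive part is
   infinite too; otherwise the difference is well defined. *)
Definition expected_log (Q : probability T R) X : \bar R :=
  if \int[Q]_w (@lne R \o X)^\- w < +oo
  then \int[Q]_w (@lne R \o X)^\+ w - \int[Q]_w (@lne R \o X)^\- w
  else -oo.

End evariables.

(* Main.v *)
Require Import Defs.
From HB Require Import structures.
From mathcomp Require Import all_boot all_order all_algebra.
From mathcomp Require Import all_classical all_reals all_analysis.
From mathcomp Require Import measurable_realfun.

(** A bounded e-variable is an e-variable, so only the inequality [<=] has
    content. It is obtained by truncation: for an e-variable [X], cutting at
    the levels [exp n] gives bounded e-variables [min X (exp n)], because
    shrinking a nonnegative function only decreases its integrals. As
    [log (min X (exp n)) = min (log X) n] and [0 <= n], truncation does not
    change the negative part of [log X], and it replaces the positive part by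
    its own truncation at [n] ([funeneg_lne_truncation],
    [funepos_lne_truncation]). Hence the negative parts have one common
    integral. If it is infinite, [X] contributes [-oo]; if it is finite, the
    positive parts increase to that of [log X], and monotone convergence
    ([cvg_integral_truncation]) makes the expected logarithms of the truncated
    variables tend to that of [X]. *)

Import Order.TTheory GRing.Theory Num.Theory.

Local Open Scope classical_set_scope.
Local Open Scope ereal_scope.

Lemma lee_lne_expeR (R : realType) (x y : \bar R) :
  -oo < y -> (y <= lne x) = (expeR y <= x).
Proof.
move=> yNy; have [x0|x0] := leP x 0.
  rewrite le0_lneNy// leeNy_eq gt_eqF//; apply/esym/negbTE.
  by rewrite -ltNge (le_lt_trans x0)// expeR_gt0.
by rewrite -lee_expeR lneK// in_itv/= leey (ltW x0).
Qed.

Lemma lne_nondecreasing (R : realType) :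
  {homo @lne R : x y / x <= y}.
Proof.
move=> x y xy; have [x0|x0] := leP x 0; first by rewrite le0_lneNy// leNye.
by rewrite lee_lne ?in_itv/= ?leey ?(ltW x0)// (le_trans (ltW x0)).
Qed.

Lemma lne_mine_expeR (R : realType) (x y : \bar R) :
  lne (mine x (expeR y)) = mine (lne x) y.
Proof.
have [xy|/ltW yx] := leP x (expeR y).
  by rewrite min_l// -[leRHS]expeRK lne_nondecreasing.
by rewrite expeRK min_r// -[leLHS]expeRK lne_nondecreasing.
Qed.

(** The Borel sets of the extended line are generated by the rays
    [`[r, +oo[]; by the Galois connection with [expeR], [lne] pulls them back
    to rays. *)
Lemma measurable_lne (R : realType) : measurable_fun [set: \bar R] (@lne R).
Proof.
apply: (measurability _ (ErealGenCInfty.measurableE R)) => //.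
move=> _ [_ [r ->] <-]; rewrite setTI.
rewrite (_ : _ @^-1` _ = [set x | expeR r%:E <= x]); last first.
  by apply/seteqP; split=> x; rewrite /= in_itv/= andbT lee_lne_expeR ?ltNyr.
rewrite -[X in measurable X]setTI.
exact: (emeasurable_fun_c_infty measurableT (@measurable_id _ _ _)).
Qed.

Lemma funepos_lne_truncation (R : realType) (T : Type) (X : T -> \bar R)
    (y : \bar R) : 0 <= y ->
  (@lne R \o (fun w => mine (X w) (expeR y)))^\+ =
  (fun w => mine ((@lne R \o X)^\+ w) y).
Proof.
move=> y0; apply/funext => w.
by rewrite !funeposE /= lne_mine_expeR max_minl (max_l y0).
Qed.

Lemma funeneg_lne_truncation (R : realType) (T : Type) (X : T -> \bar R)
    (y : \bar R) : 0 <= y ->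
  (@lne R \o (fun w => mine (X w) (expeR y)))^\- = (@lne R \o X)^\-.
Proof.
move=> y0; apply/funext => w.
rewrite !funenegE /= lne_mine_expeR oppe_min -maxA (@max_r _ _ (- y))//.
by rewrite oppe_le0.
Qed.

Lemma cvg_integral_truncation (R : realType) (d : measure_display)
    (T : measurableType d) (mu : {measure set T -> \bar R}%R) (f : T -> \bar R) :
  measurable_fun setT f -> (forall w, 0 <= f w) ->
  \int[mu]_w mine (f w) n%:R%:E @[n --> \oo] --> \int[mu]_w f w.
Proof.
move=> mf f0.
have <- : \int[mu]_w limn (fun n => mine (f w) n%:R%:E) = \int[mu]_w f w.
  apply: eq_integral => w _; apply/cvg_lim => //.
  have [->|fwy] := eqVneq (f w) +oo.
    rewrite (_ : (fun _ => _) = (fun n => (n%:R : R)%:E)).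
      by apply/cvgenyP; exact: cvg_id.
    by apply/funext => n; rewrite min_r// leey.
  have fwfin : f w \is a fin_num by rewrite ge0_fin_numE// ltey.
  apply: cvg_near_cst; near=> n; apply: min_l.
  rewrite -(fineK fwfin) lee_fin; near: n; exact: nbhs_infty_ger.
apply: cvg_monotone_convergence => //.
- by move=> n; exact: measurable_mine.
- by move=> n w _; rewrite le_min f0 lee_fin ler0n.
- by move=> w _ m n mn; rewrite le_min ge_min lexx ge_min lee_fin ler_nat mn orbT.
Unshelve. all: by end_near. Qed.

Lemma bounded_evariable_truncation (R : realType) (d : measure_display)
    (T : measurableType d) (PP : set (probability T R)) (X : T -> \bar R)
    (c : R) : (0 <= c)%R -> evariables PP X ->
  bounded_evariables PP (fun w => mine (X w) c%:E).
Proof.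
move=> c0 [mX X0 X1].
have mXc : measurable_fun setT (fun w => mine (X w) c%:E).
  exact: measurable_mine.
have Xc0 w : 0 <= mine (X w) c%:E by rewrite le_min X0 lee_fin.
split; first split=> //.
- move=> P /X1; apply: le_trans; apply: ge0_le_integral => // w _.
  by rewrite ge_min lexx.
- apply: (@le_lt_trans _ _ c%:E); last exact: ltry.
  by apply/ereal_supP => _ [w _ <-]; rewrite ge_min lexx orbT.
Qed.

(** When the common integral of the negative parts is finite, it can be moved
    to the side of [s], so that only the positive parts pass to the limit. *)
Lemma expected_log_le_truncations (R : realType) (d : measure_display)
    (T : measurableType d) (Q : probability T R) (X : T -> \bar R)
    (s : \bar R) : measurable_fun setT X ->
  (forall n : nat,
     expected_log Q (fun w => mine (X w) (expeR n%:R%:E)) <= s) ->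
  expected_log Q X <= s.
Proof.
move=> mX; rewrite /expected_log => Xs.
case: ifPn => [negoo|_]; last exact: leNye.
have neg_fin : \int[Q]_w (@lne R \o X)^\- w \is a fin_num.
  by rewrite ge0_fin_numE// integral_ge0// => w _; exact: funeneg_ge0.
have mpos : measurable_fun setT (@lne R \o X)^\+.
  by apply: measurable_funepos; apply: measurableT_comp => //; exact: measurable_lne.
have cvg_pos := @cvg_integral_truncation R d T Q _ mpos (fun=> funepos_ge0 _ _).
rewrite leeBlDr// -(cvg_lim _ cvg_pos)//.
apply: lime_le; first by apply/cvg_ex; eexists; exact: cvg_pos.
apply: nearW => n; have n0 : 0 <= (n%:R : R)%:E by rewrite lee_fin ler0n.
move: (Xs n); rewrite (funeneg_lne_truncation _ _ _ _ n0) negoo.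
by rewrite (funepos_lne_truncation _ _ _ _ n0) leeBlDr.
Qed.

Theorem lemma2p6 (R : realType) (d : measure_display) (T : measurableType d)
    (PP : set (probability T R)) (PP0 : PP !=set0) (Q : probability T R) :
  ereal_sup [set expected_log Q X | X in evariables PP] =
  ereal_sup [set expected_log Q X | X in bounded_evariables PP].
Proof.
apply/eqP; rewrite eq_le; apply/andP; split; last first.
  by apply: ereal_sup_le => _ [X [EX _] <-]; exists X.
apply/ereal_supP => _ [X EX <-]; have [mX _ _] := EX.
apply: expected_log_le_truncations => // n.
apply: ereal_sup_ubound; eexists; last by [].
by apply: bounded_evariable_truncation => //; exact: expR_ge0.
Qed.
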